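(* Let $V$ be a vertex operator algebra such that $V_n=0$ for $n<-1$. Then the following are equivalent: (a) $V$ is local; (b) $V$ is indecomposable; (c) $Z(V)$ is a local algebra; (d) $V_0$ is a commutative, power associative local algebra with respect to the product $a*b=\tfrac12\bigl(a(-1)b+b(-1)a\bigr)$.
   Context: A vertex operator algebra $V$ is a (nonzero) complex vector space with vertex operators $Y(v,z)=\sum_{n\in\mathbf{Z}} v(n)z^{-n-1}$, vacuum vector $\mathbf{1}$ and conformal vector $\omega$, $Y(\omega,z)=\sum_n L(n)z^{-n-2}$, satisfying the usual axioms; $V=\bigoplus_{n\in\mathbf{Z}}V_n$ is the $L(0)$-eigenspace grading, with $\dim V_n<\infty$ and $V_n=0$ for $n$ sufficiently small. An ideal of $V$ is a subspace $I$ with $u(n)a\in I$ for all $u\in V$, $a\in I$, $n\in\mathbf{Z}$. $V$ is local if it has a unique maximal (proper) ideal; $V$ is indecomposable if it is indecomposable as a module over itself (adjoint module), i.e. it is not the direct sum of two nonzero ideals. The center is $Z(V)=\{v\in V\mid L(-1)v=0\}$; it is contained in $V_0$ and is a finite-dimensional commutative associative unital algebra under $ab=a(-1)b$, with identity $\mathbf{1}$. A finite-dimensional nonassociative unital algebra $A$ is power associative if for each $a\in A$ the subalgebra generated by $a$ is associative. An ideal of such an $A$ is nil if all its elements are nilpotent; $A$ has a unique maximal nil ideal, its nil radical. A power associative algebra $A$ is called local if its nil radical is the unique maximal ideal of $A$ and has codimension $1$ in $A$. *)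

(* Defs.v *)
(* R[i] is the field of complex numbers over R : realType. *)
From mathcomp Require Import all_boot all_order all_algebra.
From mathcomp Require Import all_classical all_reals.
From mathcomp Require Import complex.

Set Implicit Arguments.
Unset Strict Implicit.
Unset Printing Implicit Defensive.

Import Order.TTheory GRing.Theory Num.Theory.
Local Open Scope classical_set_scope.
Local Open Scope ring_scope.

Definition is_subspace (K : fieldType) (W : lmodType K) (S : set W) : Prop :=
  submod_closed (mem S).

Definition findim (K : fieldType) (W : lmodType K) (S : set W) : Prop :=
  exists s : seq W, forall v, S v ->
    exists c : 'I_(size s) -> K, v = \sum_(i < size s) c i *: s`_i.

(* A nonassociative algebra is given by a subspace A of an ambient space W, a
   product mul : W -> W -> W of which only the restriction to A matters, and
   an element e of A. *)
Section Algebras.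
Variables (K : fieldType) (W : lmodType K).
Variables (A : set W) (mul : W -> W -> W) (e : W).

Record findim_unital_algebra : Prop := {
  alg_subspace : is_subspace A;
  alg_findim : findim A;
  alg_mul : forall a b, A a -> A b -> A (mul a b);
  alg_linearl : forall (c : K) a b x, A a -> A b -> A x ->
    mul (c *: a + b) x = c *: mul a x + mul b x;
  alg_linearr : forall (c : K) a b x, A a -> A b -> A x ->
    mul x (c *: a + b) = c *: mul x a + mul x b;
  alg_unit : A e;
  alg_unitl : forall a, A a -> mul e a = a;
  alg_unitr : forall a, A a -> mul a e = a }.

Definition alg_commutative : Prop :=
  forall a b, A a -> A b -> mul a b = mul b a.

Definition subalgebra (B : set W) : Prop :=
  [/\ B `<=` A, is_subspace B & forall a b, B a -> B b -> B (mul a b)].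

Definition subalgebra_gen (a : W) : set W := smallest subalgebra [set a].

Definition power_associative : Prop :=
  forall a, A a -> forall x y z, subalgebra_gen a x -> subalgebra_gen a y ->
    subalgebra_gen a z -> mul x (mul y z) = mul (mul x y) z.

Definition alg_ideal (I : set W) : Prop :=
  [/\ I `<=` A, is_subspace I &
      forall a x, A a -> I x -> I (mul a x) /\ I (mul x a)].

Definition alg_maximal_ideal (I : set W) : Prop :=
  [/\ alg_ideal I, I <> A &
      forall J, alg_ideal J -> I `<=` J -> J <> A -> J = I].

(* [iter n (mul a) a] is the power of exponent n + 1 of a. *)
Definition alg_nilpotent (a : W) : Prop := exists n, iter n (mul a) a = 0.

Definition nil_ideal (I : set W) : Prop :=
  alg_ideal I /\ forall a, I a -> alg_nilpotent a.

Definition maximal_nil_ideal (I : set W) : Prop :=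
  nil_ideal I /\ forall J, nil_ideal J -> I `<=` J -> J = I.

Definition is_nil_radical (N : set W) : Prop := unique maximal_nil_ideal N.

(* The quotient A / N is spanned by the nonzero class of x. *)
Definition codim1 (N : set W) : Prop :=
  exists x, [/\ A x, ~ N x & forall v, A v -> exists c : K, N (v - c *: x)].

Definition local_algebra : Prop :=
  [/\ findim_unital_algebra, power_associative &
      exists N, [/\ is_nil_radical N, unique alg_maximal_ideal N & codim1 N]].

End Algebras.

(* Generalized binomial coefficient p (p - 1) ... (p - i + 1) / i! for p in Z. *)
Definition binz (K : fieldType) (p : int) (i : nat) : K :=
  (\prod_(j < i) (p%:~R - j%:R)) / i`!%:R.

(* [Y u n] is the mode u(n) of the vertex operator
   Y(u, z) = \sum_n u(n) z^(-n-1). *)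
Section VertexOperatorAlgebras.
Variables (R : realType) (V : lmodType R[i]).
Variables (Y : V -> int -> V -> V) (vac omega : V).

(* Since Y(omega, z) = \sum_n L(n) z^(-n-2). *)
Definition Lmode (n : int) : V -> V := Y omega (n + 1).

Definition weight_space (n : int) : set V :=
  [set v | Lmode 0 v = n%:~R *: v].

(* [borcherds] is the Jacobi identity
     z0^-1 delta((z1 - z2) / z0) Y(u, z1) Y(v, z2) w
       - z0^-1 delta((z2 - z1) / - z0) Y(v, z2) Y(u, z1) w
     = z2^-1 delta((z1 - z0) / z2) Y(Y(u, z0) v, z2) w
   at the coefficient of z0^(-r-1) z1^(-p-1) z2^(-q-1).  By [truncation] both
   sums over i >= 0 have finitely many nonzero terms, so that the identity
   holds iff all the sufficiently long partial sums agree.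
   [graded] only asks that the weight spaces span V: they are eigenspaces of
   L(0) for distinct eigenvalues, so their sum is direct. *)
Record is_voa : Prop := {
  nontrivial : exists v : V, v != 0;
  linear_state : forall n w, linear (fun u => Y u n w);
  linear_mode : forall u n, linear (Y u n);
  truncation : forall u v, exists N : int, forall n, N <= n -> Y u n v = 0;
  vacuum : forall n v, Y vac n v = if n == -1 then v else 0;
  creation : forall v, Y v (-1) vac = v;
  creation_regular : forall v n, 0 <= n -> Y v n vac = 0;
  borcherds : forall (u v w : V) (p q r : int),
    exists N : nat, forall M : nat, (N <= M)%N ->
      \sum_(i < M) binz R[i] p i *: Y (Y u (r + i%:Z) v) (p + q - i%:Z) w =
      \sum_(i < M) ((-1) ^+ i * binz R[i] r i) *:
        (Y u (p + r - i%:Z) (Y v (q + i%:Z) w)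
         - (-1 : R[i]) ^ r *: Y v (q + r - i%:Z) (Y u (p + i%:Z) w));
  virasoro : exists c : R[i], forall (m n : int) (v : V),
    Lmode m (Lmode n v) - Lmode n (Lmode m v) =
      (m - n)%:~R *: Lmode (m + n) v
      + (if m + n == 0 then ((m ^+ 3 - m)%:~R / 12%:R * c) *: v else 0);
  translation : forall (v : V) (n : int) (w : V),
    Y (Lmode (-1) v) n w = - n%:~R *: Y v (n - 1) w;
  graded : forall v, exists (s : seq int) (f : int -> V),
    (forall n, weight_space n (f n)) /\ v = \sum_(n <- s) f n;
  weight_findim : forall n, findim (weight_space n);
  weight_bounded : exists N : int, forall n, n < N ->
    weight_space n = [set 0] }.

Definition voa_ideal (I : set V) : Prop :=
  is_subspace I /\ forall u n a, I a -> I (Y u n a).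

Definition voa_maximal_ideal (I : set V) : Prop :=
  [/\ voa_ideal I, I <> setT &
      forall J, voa_ideal J -> I `<=` J -> J <> setT -> J = I].

Definition voa_local : Prop := exists! M : set V, voa_maximal_ideal M.

Definition voa_indecomposable : Prop :=
  ~ exists I J : set V,
      [/\ voa_ideal I /\ I <> [set 0], voa_ideal J /\ J <> [set 0],
          I `&` J = [set 0] & forall v, exists a b, [/\ I a, J b & v = a + b]].

Definition center : set V := [set v | Lmode (-1) v = 0].

Definition center_mul (a b : V) : V := Y a (-1) b.

Definition jordan_mul (a b : V) : V := 2%:R^-1 *: (Y a (-1) b + Y b (-1) a).

End VertexOperatorAlgebras.

(* Main.v *)
Require Import Defs.
From mathcomp Require Import all_boot all_order all_algebra.
From mathcomp Require Import all_classical all_reals.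
From mathcomp Require Import complex.

Import Order.TTheory GRing.Theory Num.Theory.
Local Open Scope classical_set_scope.
Local Open Scope ring_scope.

Set Implicit Arguments.
Unset Strict Implicit.
Unset Printing Implicit Defensive.

(* A nontrivial idempotent of the center splits V, so (b) makes every idempotent
   of Z(V) trivial.  For a in V_0 one has a(i)a = 0 for i >= 0, because
   V_n = 0 for n < -1 and a(0)a is antisymmetric; hence the modes of a commute and
   C[a] is a commutative associative algebra with derivation L(-1), whose
   idempotents are killed by L(-1), i.e. central.  Without nontrivial idempotents
   every a in V_0 is therefore c 1 + n with n nilpotent.  If n is nilpotent then
   so is n(-1) on V_0, so the trace of a(-1) on V_0 shows that the nilpotent
   elements form a hyperplane N; polarizing n * n makes N an ideal, and V_0 and
   Z(V) are local.  Conversely, ideals of V are graded and a proper one meets V_0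
   inside N, so a sum of proper ideals is proper. *)

(** * Linear algebra *)

Section LinearMaps.
Variables (K : fieldType) (U W : lmodType K) (f : U -> W).
Hypothesis lf : linear f.

Lemma lin_add u v : f (u + v) = f u + f v.
Proof. by rewrite -[u]scale1r lf !scale1r. Qed.

Lemma lin_0 : f 0 = 0.
Proof. by apply: (@addrI _ (f 0)); rewrite -lin_add !addr0. Qed.

Lemma lin_scale c u : f (c *: u) = c *: f u.
Proof. by rewrite -[c *: u]addr0 lf lin_0 addr0. Qed.

Lemma lin_opp u : f (- u) = - f u.
Proof. by rewrite -scaleN1r lin_scale scaleN1r. Qed.

Lemma lin_sub u v : f (u - v) = f u - f v.
Proof. by rewrite lin_add lin_opp. Qed.

Lemma lin_sum (I : Type) (r : seq I) (P : pred I) (F : I -> U) :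
  f (\sum_(i <- r | P i) F i) = \sum_(i <- r | P i) f (F i).
Proof. exact: (big_morph f lin_add lin_0). Qed.

End LinearMaps.

Section Subspace.
Variables (K : fieldType) (W : lmodType K) (S : set W).

Lemma is_subspaceP :
  is_subspace S <-> S 0 /\ forall c u v, S u -> S v -> S (c *: u + v).
Proof.
split=> -[S0 SL]; split.
- by rewrite -in_setE.
- by move=> c u v Su Sv; rewrite -in_setE; apply: SL; rewrite in_setE.
- by rewrite in_setE.
- by move=> c u v; rewrite !in_setE; apply: SL.
Qed.

Hypothesis subS : is_subspace S.

Lemma subspace0 : S 0. Proof. by case/is_subspaceP: subS. Qed.

Lemma subspaceD u v : S u -> S v -> S (u + v).
Proof. by case/is_subspaceP: subS => _ SL Su Sv; rewrite -[u]scale1r; apply: SL. Qed.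

Lemma subspaceZ c u : S u -> S (c *: u).
Proof.
case/is_subspaceP: subS => S0 SL Su.
by rewrite -[_ *: _]addr0; apply: SL.
Qed.

Lemma subspaceN u : S u -> S (- u).
Proof. by rewrite -scaleN1r; apply: subspaceZ. Qed.

Lemma subspaceB u v : S u -> S v -> S (u - v).
Proof. by move=> Su /subspaceN; apply: subspaceD. Qed.

Lemma subspace_sum (I : Type) (r : seq I) (P : pred I) (F : I -> W) :
  (forall i, P i -> S (F i)) -> S (\sum_(i <- r | P i) F i).
Proof. by move=> SF; apply: big_ind => //; [apply: subspace0 | apply: subspaceD]. Qed.

End Subspace.

(** The coordinates of more than [size s] vectors on a spanning list [s] form a matrix with more
    rows than columns, so its left kernel is nonzero. *)
Lemma findim_dependent (K : fieldType) (W : lmodType K) (S : set W) :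
  findim S -> exists d : nat, forall (m : nat) (v : 'I_m -> W), (d < m)%N ->
    (forall i, S (v i)) -> exists u : 'rV[K]_m, u != 0 /\ \sum_i u 0 i *: v i = 0.
Proof.
move=> [s Ss]; exists (size s) => m v dm Sv.
have [C vE] := choice (fun i => Ss _ (Sv i)).
pose M := \matrix_(i < m, j < size s) C i j.
have : kermx M != 0.
  rewrite -mxrank_eq0 mxrank_ker subn_eq0 -ltnNge.
  exact: leq_ltn_trans (rank_leq_col M) dm.
case/rowV0Pn => u /sub_kermxP uM u0; exists u; split=> //.
under eq_bigr do rewrite vE scaler_sumr.
rewrite exchange_big big1 //= => j _.
under eq_bigr do rewrite scalerA.
rewrite -scaler_suml.
move/matrixP: uM => /(_ 0 j); rewrite !mxE => uM.
rewrite [X in X *: _](_ : _ = 0) ?scale0r // -[RHS]uM.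
by apply: eq_bigr => i _; rewrite mxE.
Qed.

(** The spanning list of [findim] need not lie in [S], so the basis is a free family of maximal
    length inside [S]; [findim_dependent] bounds the lengths. *)
Lemma findim_basis (K : fieldType) (W : lmodType K) (S : set W) :
  is_subspace S -> findim S -> exists n (b : 'I_n -> W),
    [/\ forall i, S (b i),
        forall v, S v -> exists u : 'rV[K]_n, v = \sum_i u 0 i *: b i &
        forall u : 'rV[K]_n, \sum_i u 0 i *: b i = 0 -> u = 0].
Proof.
move=> subS /findim_dependent[d dep].
pose P n := `[< exists b : 'I_n -> W, (forall i, S (b i)) /\
  forall u : 'rV[K]_n, \sum_i u 0 i *: b i = 0 -> u = 0 >].
have P0 : exists n, P n.
  exists 0; apply/asboolP; exists (fun=> 0); split=> [i|u _]; first by case: i.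
  exact: thinmx0.
have leP n : P n -> (n <= d)%N.
  move=> /asboolP[b [Sb freeb]]; rewrite leqNgt; apply/negP => dn.
  have [u [u0 /freeb uE]] := dep n b dn Sb; by rewrite uE eqxx in u0.
case: (ex_maxnP P0 leP) => n /asboolP[b [Sb freeb]] maxn.
exists n, b; split=> // v Sv; apply: contrapT => nv.
have : P n.+1; last by move/maxn; rewrite ltnn.
apply/asboolP; exists (fun i => if unlift ord_max i is Some j then b j else v).
split=> [i|u]; first by case: (unlift _ i).
rewrite big_ord_recr /= unlift_none => E.
have {}E : \sum_(i < n) u 0 (widen_ord (leqnSn n) i) *: b i + u 0 ord_max *: v = 0.
  rewrite -[RHS]E; congr (_ + _); apply: eq_bigr => i _.
  have -> : widen_ord (leqnSn n) i = lift ord_max i.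
    by apply/val_inj; rewrite /= /bump leqNgt ltn_ord.
  by rewrite liftK.
have um : u 0 ord_max = 0.
  apply/eqP/negPn/negP => um; apply: nv.
  exists (- (u 0 ord_max)^-1 *: \row_i u 0 (widen_ord (leqnSn n) i)).
  under eq_bigr do rewrite !mxE -scalerA.
  rewrite -scaler_sumr; move/eqP: E; rewrite addr_eq0 => /eqP ->.
  by rewrite scalerN scaleNr opprK scalerA mulVf // scale1r.
move: E; rewrite um scale0r addr0 => E.
have /rowP u0 : \row_i u 0 (widen_ord (leqnSn n) i) = 0.
  by apply: freeb; rewrite -[RHS]E; apply: eq_bigr => i _; rewrite mxE.
apply/rowP => i; rewrite mxE.
have [j ->|->] := unliftP ord_max i => //.
have := u0 j; rewrite !mxE => <-; congr (u 0 _); apply/val_inj.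
by rewrite /= /bump leqNgt ltn_ord.
Qed.

(** Every eigenvalue is 0, so the characteristic polynomial is a power of ['X]; its subleading
    coefficient is minus the trace. *)
Lemma mxtrace_nilpotent (K : closedFieldType) (n : nat) (M : 'M[K]_n) (k : nat) :
  (forall u : 'rV_n, iter k (mulmxr M) u = 0) -> \tr M = 0.
Proof.
case: n M => [|n] M Mk; first by rewrite /mxtrace big_ord0.
have eig a : eigenvalue M a -> a = 0.
  case/eigenvalueP=> v vM v0; apply/eqP.
  have E : iter k (mulmxr M) v = a ^+ k *: v.
    elim: k {Mk} => [|k IH]; first by rewrite expr0 scale1r.
    by rewrite iterS IH /= -scalemxAl vM scalerA -exprSr.
  by move/eqP: (Mk v); rewrite E scaler_eq0 (negPf v0) orbF expf_eq0 => /andP[].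
apply/eqP; rewrite -oppr_eq0 -char_poly_trace //.
have [r rE] := closed_field_poly_normal (char_poly M).
have /eqP lc1 := char_poly_monic M.
rewrite lc1 scale1r in rE.
have {}rE : char_poly M = 'X^(size r).
  have r0 z : z \in r -> z = 0.
    by move=> zr; apply: eig; rewrite eigenvalue_root_char rE root_prod_XsubC.
  rewrite rE -[in RHS](count_predT r) -iter_mulr_1 -big_const_seq.
  by rewrite big_seq [RHS]big_seq; apply: eq_bigr => z /r0 ->; rewrite subr0.
have /eqP := size_char_poly M; rewrite rE size_polyXn eqSS => /eqP ->.
by rewrite coefXn /= (ltn_eqF (ltnSn n)).
Qed.

(** In a basis of [S] the relation becomes an identity of matrices. Taking traces gives n c = 0 with
    n = dim S, and [v0] makes n nonzero. *)
Lemma scalar_sum_nilpotent (K : numClosedFieldType) (W : lmodType K) (S : set W)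
    (f g h : W -> W) (c : K) (v0 : W) :
  is_subspace S -> findim S ->
  linear f -> linear g -> linear h ->
  (forall v, S v -> S (f v)) -> (forall v, S v -> S (g v)) ->
  (forall v, S v -> S (h v)) ->
  (exists k, forall v, S v -> iter k f v = 0) ->
  (exists k, forall v, S v -> iter k g v = 0) ->
  (exists k, forall v, S v -> iter k h v = 0) ->
  (forall v, S v -> f v + g v = c *: v + h v) ->
  S v0 -> v0 != 0 -> c = 0.
Proof.
move=> subS fdS lf lg lh Sf Sg Sh nf ng nh fgh Sv0 v0n.
have [n [b [Sb spanb freeb]]] := findim_basis subS fdS.
pose lc (u : 'rV[K]_n) := \sum_i u 0 i *: b i.
have llc : linear lc.
  move=> a u v; rewrite /lc scaler_sumr -big_split /=; apply: eq_bigr => i _.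
  by rewrite !mxE scalerDl scalerA.
have Slc u : S (lc u) by apply: subspace_sum => // i _; apply: subspaceZ.
have lc_inj : injective lc.
  move=> u v /eqP; rewrite -subr_eq0 -(lin_sub llc) => /eqP /freeb /eqP.
  by rewrite subr_eq0 => /eqP.
have mxof (T : W -> W) : linear T -> (forall v, S v -> S (T v)) ->
    {M : 'M[K]_n | forall u, T (lc u) = lc (u *m M)}.
  move=> lT ST; apply: cid.
  have /choice[C CE] : forall i, exists u, T (b i) = lc u.
    by move=> i; apply: spanb; apply: ST.
  exists (\matrix_i C i) => u.
  rewrite mulmx_sum_row (lin_sum llc) (lin_sum lT).
  by apply: eq_bigr => i _; rewrite rowK (lin_scale lT) (lin_scale llc) CE.
have trnil (T : W -> W) (M : 'M_n) : (forall u, T (lc u) = lc (u *m M)) ->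
    (exists k, forall v, S v -> iter k T v = 0) -> \tr M = 0.
  move=> TM [k Tk]; apply: (@mxtrace_nilpotent _ _ _ k) => u.
  apply: lc_inj; rewrite (lin_0 llc) -(Tk _ (Slc u)).
  by elim: k {Tk} => //= k <-; rewrite TM.
have [F FE] := mxof f lf Sf; have [G GE] := mxof g lg Sg.
have [H HE] := mxof h lh Sh.
have FGH : F + G = c%:M + H.
  apply/row_matrixP => i; rewrite !rowE; apply: lc_inj.
  rewrite !mulmxDr !(lin_add llc) /= -FE -GE -HE fgh //.
  by rewrite mul_mx_scalar (lin_scale llc).
move/(congr1 mxtrace): FGH.
rewrite !mxtraceD mxtrace_scalar (trnil f) // (trnil g) // (trnil h) // !addr0.
move/esym/eqP; rewrite mulrn_eq0 => /orP[/eqP n0|/eqP//].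
have [u v0E] := spanb _ Sv0.
move: v0n; rewrite v0E big1 ?eqxx // => i _.
by have := ltn_ord i; rewrite [X in (_ < X)%N]n0.
Qed.

(** * Polynomials in an operator *)

Section PolyOp.
Variables (K : fieldType) (W : lmodType K) (T : W -> W).
Hypothesis lT : linear T.
Implicit Types p q : {poly K}.

Definition poly_op (p : {poly K}) (w : W) : W :=
  \sum_(i < size p) p`_i *: iter i T w.

Lemma poly_op_widen n p w : (size p <= n)%N ->
  poly_op p w = \sum_(i < n) p`_i *: iter i T w.
Proof.
move=> pn; rewrite /poly_op (big_ord_widen n (fun i => p`_i *: iter i T w)) //.
rewrite big_mkcond; apply: eq_bigr => i _; case: ltnP => // pi.
by rewrite nth_default // scale0r.
Qed.

Lemma poly_op_linearl w : linear (poly_op^~ w).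
Proof.
move=> c p q; pose n := maxn (size p) (size q).
have pn : (size p <= n)%N by apply: leq_maxl.
have qn : (size q <= n)%N by apply: leq_maxr.
have cn : (size (c *: p + q)%R <= n)%N.
  rewrite (leq_trans (size_polyD _ _)) // geq_max qn andbT.
  exact: leq_trans (size_scale_leq _ _) pn.
rewrite (poly_op_widen _ pn) (poly_op_widen _ qn) (poly_op_widen _ cn).
rewrite scaler_sumr -big_split /=; apply: eq_bigr => i _.
by rewrite coefD coefZ scalerDl scalerA.
Qed.

Lemma poly_opC c w : poly_op c%:P w = c *: w.
Proof.
by rewrite (@poly_op_widen 1) ?size_polyC_leq1 // big_ord1 coefC.
Qed.

Lemma poly_op1 w : poly_op 1 w = w.
Proof. by rewrite poly_opC scale1r. Qed.

Lemma poly_opMX p w : poly_op (p * 'X) w = T (poly_op p w).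
Proof.
rewrite (@poly_op_widen (size p).+1); last first.
  by rewrite (leq_trans (size_polyMleq _ _)) // size_polyX addn2.
rewrite big_ord_recl coefMX scale0r add0r (lin_sum lT); apply: eq_bigr => i _.
by rewrite coefMX (lin_scale lT).
Qed.

Lemma poly_opX w : poly_op 'X w = T w.
Proof. by rewrite -['X]mul1r poly_opMX poly_op1. Qed.

Lemma poly_opM p q w : poly_op (p * q) w = poly_op p (poly_op q w).
Proof.
elim/poly_ind: p => [|p c IH].
  by rewrite mul0r /poly_op size_poly0 !big_ord0.
rewrite mulrDl -mulrAC mul_polyC !(lin_add (poly_op_linearl _)).
by rewrite !poly_opMX IH poly_opC (lin_scale (poly_op_linearl _)).
Qed.

Lemma poly_op0 p : poly_op p 0 = 0.
Proof.
rewrite /poly_op big1 // => i _; rewrite [iter _ _ _](_ : _ = 0) ?scaler0 //.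
by elim: (i : nat) => //= k ->; rewrite (lin_0 lT).
Qed.

Lemma poly_op_subspace (S : set W) p w : is_subspace S ->
  (forall v, S v -> S (T v)) -> S w -> S (poly_op p w).
Proof.
move=> subS ST Sw; apply: subspace_sum => // i _; apply: subspaceZ => //.
by elim: (i : nat) => //= k; apply: ST.
Qed.

Lemma poly_op_Xn k w : poly_op 'X^k w = iter k T w.
Proof.
elim: k => [|k IH]; first by rewrite poly_op1.
by rewrite exprSr poly_opMX IH.
Qed.

(** Sufficiently many iterates of [T] on [w] are linearly dependent; the coefficients of the
    relation are those of [p]. *)
Lemma poly_op_eq0 (S : set W) w : is_subspace S -> findim S ->
  (forall v, S v -> S (T v)) -> S w -> exists2 p, p != 0 & poly_op p w = 0.
Proof.
move=> subS /findim_dependent[d dep] ST Sw.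
have [|u [u0 uE]] := dep d.+1 (fun i => iter i T w) (ltnSn d).
  by move=> i; elim: (i : nat) => //= k; apply: ST.
exists (rVpoly u); first by apply: contra_neq u0 => u0; rewrite -[u]rVpolyK u0 linear0.
rewrite (@poly_op_widen d.+1) ?size_poly // -[RHS]uE.
by apply: eq_bigr => i _; rewrite coef_rVpoly_ord.
Qed.

End PolyOp.

(* If p = ('X - c)^m q with q(c) != 0, a Bezout relation between the two factors
   yields an idempotent; when it is trivial, one of the factors annihilates w. *)
Lemma poly_op_unipotent (K : closedFieldType) (W : lmodType K) (T : W -> W)
    (lT : linear T) (w : W) (p : {poly K}) :
  w != 0 -> p != 0 -> poly_op T p w = 0 ->
  (forall e, poly_op T (e * e) w = poly_op T e w ->
     poly_op T e w = 0 \/ poly_op T e w = w) ->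
  exists c k, poly_op T (('X - c%:P) ^+ k) w = 0.
Proof.
move=> w0 p0 pw idem.
(* Induction on the size of [p]: if the annihilating factor is [q], it takes the place of [p]; it is
   smaller because [c] is a root of [p]. *)
have [n] := ubnP (size p); elim: n => // n IH in p p0 pw *; rewrite ltnS => pn.
have [/eqP/size_poly1P[c c0 pE]|/closed_rootP[c pc]] := eqVneq (size p) 1.
  move/eqP: pw; rewrite pE poly_opC scaler_eq0 (negPf w0) orbF => /eqP cE.
  by rewrite cE eqxx in c0.
have [m [q]] := multiplicity_XsubC p c; rewrite p0 /= => qc pE.
have [q0|q0] := eqVneq q 0; first by rewrite pE q0 mul0r eqxx in p0.
have cop : coprimep (('X - c%:P) ^+ m) q.
  by apply: coprimep_expl; rewrite coprimep_sym coprimep_XsubC.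
have /Bezout_eq1_coprimepP[[s t] /= st] := cop.
pose e := s * ('X - c%:P) ^+ m.
have tqE : t * q = 1 - e by rewrite -st addrC addKr.
have stpE : s * t * p = e - e * e.
  by rewrite -[X in X - _]mulr1 -mulrBr -tqE pE [RHS]mulrACA [q * _]mulrC.
have kill r : poly_op T (r * p) w = 0 by rewrite poly_opM // pw poly_op0.
have [|ew|ew] := idem e.
- apply/eqP; rewrite eq_sym -subr_eq0 -(lin_sub (poly_op_linearl _ _)) -stpE.
  by rewrite kill.
- exists c, m.
  rewrite -[_ ^+ _]mulr1 -st -/e mulrDr (lin_add (poly_op_linearl _ _)).
  rewrite poly_opM // ew poly_op0 // add0r.
  by rewrite mulrCA [_ * q]mulrC -pE kill.
- apply: (IH q) => //.
    by rewrite -ew -poly_opM // /e mulrCA -pE kill.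
  apply: leq_trans pn; move: pc; rewrite [in root p]pE pE size_mul ?size_exp_XsubC //.
    rewrite addnS /= -addn1 leq_add2l lt0n.
    by apply: contraTneq => ->; rewrite expr0 mulr1.
  by rewrite expf_neq0 // polyXsubC_eq0.
Qed.

(** * Local algebras *)

Section LocalAlgebras.
Variables (K : numFieldType) (W : lmodType K).
Variables (A : set W) (mul : W -> W -> W) (e : W).
Hypothesis algA : findim_unital_algebra A mul e.

Let subA : is_subspace A := alg_subspace algA.

Lemma mul_addl a b x : A a -> A b -> A x -> mul (a + b) x = mul a x + mul b x.
Proof. by move=> Aa Ab Ax; rewrite -[a]scale1r (alg_linearl algA) // !scale1r. Qed.

Lemma mul_addr a b x : A a -> A b -> A x -> mul x (a + b) = mul x a + mul x b.
Proof. by move=> Aa Ab Ax; rewrite -[a]scale1r (alg_linearr algA) // !scale1r. Qed.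

Lemma mul_subl a b x : A a -> A b -> A x -> mul (a - b) x = mul a x - mul b x.
Proof.
move=> Aa Ab Ax; rewrite addrC -scaleN1r (alg_linearl algA) //.
by rewrite scaleN1r addrC.
Qed.

Lemma mul_scalel c a x : A a -> A x -> mul (c *: a) x = c *: mul a x.
Proof.
move=> Aa Ax; have A0 := subspace0 subA.
have m0 : mul 0 x = 0 by rewrite -{1}(subrr a) mul_subl // subrr.
by rewrite -[c *: a]addr0 (alg_linearl algA) // m0 addr0.
Qed.

Lemma iter_mulA n a : A a -> A (iter n (mul a) a).
Proof. by move=> Aa; elim: n => //= n; apply: alg_mul algA _ _ Aa. Qed.

Lemma iter_mul_idem n a : mul a a = a -> iter n (mul a) a = a.
Proof. by move=> aa; elim: n => //= n ->. Qed.

Lemma idem_nilpotent a : mul a a = a -> alg_nilpotent mul a -> a = 0.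
Proof. by move=> aa [n]; rewrite iter_mul_idem. Qed.

Lemma ideal_full J : alg_ideal A mul J -> J e -> J = A.
Proof.
move=> [JA _ JM] Je; apply/seteqP; split=> // a Aa.
by rewrite -(alg_unitr algA Aa); case: (JM a e).
Qed.

(* Modulo J the powers of e - j are all equal, hence zero. *)
Lemma ideal_unipotent J j :
  alg_ideal A mul J -> J j -> alg_nilpotent mul (e - j) -> J e.
Proof.
move=> [JA subJ JM] Jj [k nk]; set n := e - j in nk.
have Ae := alg_unit algA.
have An : A n by apply: subspaceB => //; apply: JA.
have Jn i : J (n - iter i (mul n) n).
  elim: i => [|i IH]; first by rewrite subrr; apply: subspace0.
  rewrite iterS; set x := iter i _ _ in IH *.
  have -> : n - mul n x = (n - x) + (x - mul n x) by rewrite addrA subrK.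
  apply: subspaceD => //.
  have Ani : A x by apply: iter_mulA.
  rewrite -[X in X - _](alg_unitl algA Ani) -mul_subl // /n opprB addrC subrK.
  by case: (JM _ _ Ani Jj).
have := Jn k; rewrite nk subr0 => {}Jn.
by rewrite -(subrK j e); apply: subspaceD.
Qed.

(** A / N is a line, so the class of any [j] outside [N] spans it, and the class of [e] is a
    multiple of it. *)
Lemma local_algebra_radical : local_algebra A mul e ->
  exists N, [/\ nil_ideal A mul N, ~ N e &
    forall j, A j -> ~ N j -> exists c, N (e - c *: j)].
Proof.
move=> [_ _ [N [[[nilN _] _] [[idN NA _] _] [x [Ax Nx cod]]]]].
exists N; split=> //; first by move=> /(ideal_full idN).
move=> j Aj Nj; have [_ subN _] := idN.
have [c Nc] := cod j Aj; have [d Nd] := cod e (alg_unit algA).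
have c0 : c != 0 by apply: contra_notN Nj => /eqP c0; rewrite c0 scale0r subr0 in Nc.
exists (d / c).
have -> : e - (d / c) *: j = (e - d *: x) - (d / c) *: (j - c *: x).
  by rewrite scalerBr scalerA divfK // opprB addrA subrK.
by apply: subspaceB => //; apply: subspaceZ.
Qed.

(** If [J] had an element [j] outside [N], some e - c j would lie in [N] and be nilpotent, and
    [ideal_unipotent] would put [e] in [J]. *)
Lemma local_algebra_proper : local_algebra A mul e ->
  exists N, [/\ is_subspace N, ~ N e &
    forall J, alg_ideal A mul J -> ~ J e -> J `<=` N].
Proof.
move=> /local_algebra_radical[N [[[NA subN NM] nilN] Ne Ncod]].
exists N; split=> // J idJ Je j Jj; apply: contrapT => Nj.
have [JA subJ _] := idJ.
have [c /nilN nc] := Ncod j (JA _ Jj) Nj.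
by apply: Je; apply: ideal_unipotent nc => //; apply: subspaceZ.
Qed.

(** An idempotent in [N] is nilpotent, hence 0. Otherwise some e - c f is in [N]; multiplying by [f]
    gives (1 - c) f in [N], so c = 1, and the idempotent e - f is nilpotent. *)
Lemma local_algebra_idem f : local_algebra A mul e -> A f -> mul f f = f ->
  f = 0 \/ f = e.
Proof.
move=> /local_algebra_radical[N [[[NA subN NM] nilN] Ne Ncod]] Af ff.
have Ae := alg_unit algA.
have [Nf|Nf] := pselect (N f); [left|right].
  by apply: idem_nilpotent => //; apply: nilN.
have [c Nc] := Ncod f Af Nf.
have : N (mul (e - c *: f) f) by case: (NM _ _ Af Nc).
have Acf : A (c *: f) by apply: subspaceZ.
rewrite mul_subl // mul_scalel // (alg_unitl algA) // ff.
rewrite -[X in X - _]scale1r -scalerBl => N1.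
have c1 : c = 1.
  apply/eqP; rewrite eq_sym -subr_eq0; apply: contra_notT Nf => c1.
  by rewrite -[f](scalerK c1); apply: subspaceZ.
move: Nc; rewrite c1 scale1r => /nilN ne.
apply/esym/eqP; rewrite -subr_eq0; apply/eqP; apply: idem_nilpotent => //.
rewrite mul_subl //; last exact: subspaceB.
rewrite (alg_unitl algA); last exact: subspaceB.
rewrite [e - f]addrC -scaleN1r (alg_linearr algA) // ff (alg_unitr algA) //.
by rewrite scaleN1r addNr subr0.
Qed.

(** Polarizing squares makes [N] closed under products, and A = N + K e makes it an ideal. An ideal
    with an element outside [N] contains [e] by [ideal_unipotent], so [N] is the largest proper
    ideal; nil ideals are proper since [e] is a nonzero idempotent. *)
Lemma local_algebra_nil (N : set W) :
  power_associative A mul -> alg_commutative A mul ->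
  is_subspace N -> N `<=` A -> (forall n, N n -> alg_nilpotent mul n) ->
  (forall n, N n -> N (mul n n)) -> ~ N e ->
  (forall a, A a -> exists c, N (a - c *: e)) ->
  local_algebra A mul e.
Proof.
move=> pA cA subN NA nilN sqN Ne Ncod; have Ae := alg_unit algA.
have mulN m n : N m -> N n -> N (mul m n).
  move=> Nm Nn; have [Am An] := (NA _ Nm, NA _ Nn).
  have : N (mul (m + n) (m + n) - mul m m - mul n n).
    do 2?[apply: subspaceB => //]; apply: sqN => //; exact: subspaceD.
  have Amn : A (m + n) by apply: subspaceD.
  rewrite mul_addl // !mul_addr // [mul n m]cA // -addrA -opprD.
  rewrite [mul m m + mul m n]addrC addrACA addrK => N2.
  rewrite -[mul m n](scalerK (_ : 2%:R != 0 :> K)) ?pnatr_eq0 //.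
  by apply: subspaceZ => //; rewrite scaler_nat mulr2n.
have mulAN a n : A a -> N n -> N (mul a n).
  move=> Aa Nn; have An := NA _ Nn; have [c Nc] := Ncod a Aa.
  have Anc := NA _ Nc.
  rewrite -[a](subrK (c *: e)) mul_addl //; last exact: subspaceZ.
  rewrite mul_scalel // (alg_unitl algA) //; apply: subspaceD => //.
    exact: mulN.
  exact: subspaceZ.
have idN : alg_ideal A mul N.
  split=> // a n Aa Nn; split; first exact: mulAN.
  by rewrite cA //; [apply: mulAN | apply: NA].
have properN J : alg_ideal A mul J -> J <> A -> J `<=` N.
  move=> idJ JA j Jj; apply: contrapT => Nj; apply: JA; apply: ideal_full => //.
  have [JA subJ _] := idJ; have [c Nc] := Ncod j (JA _ Jj).
  have c0 : c != 0 by apply: contra_notN Nj => /eqP c0; rewrite c0 scale0r subr0 in Nc.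
  apply: (@ideal_unipotent J (c^-1 *: j)) => //; first exact: subspaceZ.
  apply: nilN; rewrite -opprB; apply: subspaceN => //.
  by rewrite -[e](scalerK c0) -scalerBr; apply: subspaceZ.
have e0 : e <> 0 by move=> e0; apply: Ne; rewrite e0; apply: subspace0.
have nilA J : nil_ideal A mul J -> J <> A.
  move=> [_ nilJ] JA; apply: e0; apply: idem_nilpotent; first exact: alg_unitl algA _ _.
  by apply: nilJ; rewrite JA.
have nilNN : nil_ideal A mul N by split.
split=> //; exists N; split.
- split.
    split=> // J nilJ NJ; apply/seteqP; split=> //.
    by apply: properN; [case: nilJ | apply: nilA].
  move=> J [nilJ maxJ]; apply: maxJ => //.
  by apply: properN; [case: nilJ | apply: nilA].
- split.
    split=> //; first exact: nilA.
    by move=> J idJ NJ JA; apply/seteqP; split=> //; apply: properN.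
  move=> J [idJ JA maxJ]; apply: maxJ => //; last exact: nilA.
  exact: properN.
- by exists e.
Qed.

End LocalAlgebras.

(** * Modes of a vertex operator algebra *)

Section BinomialCoefficients.
Variable K : numFieldType.

Lemma binz0 (p : int) : binz K p 0 = 1.
Proof. by rewrite /binz big_ord0 fact0 divr1. Qed.

Lemma binz1 (p : int) : binz K p 1 = p%:~R.
Proof. by rewrite /binz big_ord1 subr0 divr1. Qed.

Lemma binz_small (n i : nat) : (n < i)%N -> binz K n i = 0.
Proof.
by move=> ni; rewrite /binz (bigD1 (Ordinal ni)) //= subrr !mul0r.
Qed.

Lemma binzN1 (i : nat) : binz K (-1) i = (-1) ^+ i.
Proof.
rewrite /binz; have i0 : i`!%:R != 0 :> K by rewrite pnatr_eq0 -lt0n fact_gt0.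
rewrite -[RHS](mulfK i0); congr (_ / _); elim: i {i0} => [|i IH].
  by rewrite big_ord0 fact0 mulr1.
have E : -1 - i%:R = - i.+1%:R :> K by rewrite -opprD nat1r.
rewrite big_ord_recr /= IH E factS natrM exprS mulN1r mulrN mulNr -mulrA.
by rewrite [i`!%:R * _]mulrC.
Qed.

End BinomialCoefficients.

Lemma big_ord_trunc (W : zmodType) (F : nat -> W) (k M : nat) :
  (forall i, (k <= i)%N -> F i = 0) -> (k <= M)%N ->
  \sum_(i < M) F i = \sum_(i < k) F i.
Proof.
move=> F0 kM; rewrite [RHS](big_ord_widen _ F kM) [RHS]big_mkcond.
by apply: eq_bigr => i _; case: ltnP => // /F0.
Qed.

Section VertexOperatorAlgebras.
Variables (R : realType) (V : lmodType R[i]).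
Variables (Y : V -> int -> V -> V) (vac omega : V).
Hypothesis hV : is_voa Y vac omega.

Let Ll n w : linear (fun u => Y u n w) := linear_state hV n w.
Let Lr u n : linear (Y u n) := linear_mode hV u n.

Lemma mode0l n w : Y 0 n w = 0. Proof. exact: (lin_0 (Ll n w)). Qed.
Lemma mode0r u n : Y u n 0 = 0. Proof. exact: (lin_0 (Lr u n)). Qed.
Lemma modeZl c u n w : Y (c *: u) n w = c *: Y u n w.
Proof. exact: (lin_scale (Ll n w)). Qed.
Lemma modeDl u v n w : Y (u + v) n w = Y u n w + Y v n w.
Proof. exact: (lin_add (Ll n w)). Qed.

(** The axiom compares partial sums of a common large length; here each side is cut at its own
    length, beyond which its terms vanish. *)
Lemma borcherds_finite u v w (p q r : int) (k l : nat) :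
  (forall i : nat, (k <= i)%N ->
     binz R[i] p i *: Y (Y u (r + i%:Z) v) (p + q - i%:Z) w = 0) ->
  (forall i : nat, (l <= i)%N ->
     ((-1) ^+ i * binz R[i] r i) *:
        (Y u (p + r - i%:Z) (Y v (q + i%:Z) w)
         - (-1 : R[i]) ^ r *: Y v (q + r - i%:Z) (Y u (p + i%:Z) w)) = 0) ->
  \sum_(i < k) binz R[i] p i *: Y (Y u (r + i%:Z) v) (p + q - i%:Z) w =
  \sum_(i < l) ((-1) ^+ i * binz R[i] r i) *:
        (Y u (p + r - i%:Z) (Y v (q + i%:Z) w)
         - (-1 : R[i]) ^ r *: Y v (q + r - i%:Z) (Y u (p + i%:Z) w)).
Proof.
move=> F0 G0; have [N NE] := borcherds hV u v w p q r.
pose M := (N + (k + l))%N.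
have kM : (k <= M)%N by rewrite /M addnCA leq_addr.
have lM : (l <= M)%N by rewrite /M addnA leq_addl.
have H := NE M (leq_addr _ _).
exact: etrans (esym (big_ord_trunc F0 kM)) (etrans H (big_ord_trunc G0 lM)).
Qed.

(** The case r = 0 of the Borcherds identity, where only the term i = 0 survives on the right. *)
Lemma commutator u v w (p q : int) (k : nat) :
  (forall i : nat, (k <= i)%N ->
     binz R[i] p i *: Y (Y u i%:Z v) (p + q - i%:Z) w = 0) ->
  Y u p (Y v q w) - Y v q (Y u p w) =
  \sum_(i < k) binz R[i] p i *: Y (Y u i%:Z v) (p + q - i%:Z) w.
Proof.
move=> F0; have := @borcherds_finite u v w p q 0 k 1.
rewrite big_ord1 !(addr0, subr0) expr0 expr0z binz0 mulr1 !scale1r.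
move=> H; rewrite -H.
- by apply: eq_bigr => i _; rewrite add0r.
- by move=> i; rewrite add0r; apply: F0.
- by move=> i i0; rewrite binz_small // mulr0 scale0r.
Qed.

Lemma commutator0 u v w (p q : int) :
  (forall i : nat, Y u i%:Z v = 0) -> Y u p (Y v q w) = Y v q (Y u p w).
Proof.
move=> uv; apply/eqP; rewrite -subr_eq0 (@commutator _ _ _ _ _ 0) ?big_ord0 //.
by move=> i _; rewrite uv mode0l scaler0.
Qed.

Lemma mode0_derivation u v w (q : int) :
  Y u 0 (Y v q w) - Y v q (Y u 0 w) = Y (Y u 0 v) q w.
Proof.
rewrite (@commutator _ _ _ _ _ 1) ?big_ord1 ?binz0 ?scale1r ?add0r ?subr0 //.
by move=> i i0; rewrite binz_small // scale0r.
Qed.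

(** The case p = 0, r = -1: one term remains on the left, and the binomial coefficients (-1)^i
    cancel the signs on the right. *)
Lemma iterate u v w (q : int) (l : nat) :
  (forall i : nat, (l <= i)%N -> Y u (-1 - i%:Z) (Y v (q + i%:Z) w) = 0) ->
  (forall i : nat, (l <= i)%N -> Y v (q - 1 - i%:Z) (Y u i%:Z w) = 0) ->
  Y (Y u (-1) v) q w =
  \sum_(i < l) (Y u (-1 - i%:Z) (Y v (q + i%:Z) w) + Y v (q - 1 - i%:Z) (Y u i%:Z w)).
Proof.
move=> v0 u0; have := @borcherds_finite u v w 0 q (-1) 1 l.
rewrite big_ord1 binz0 scale1r !(addr0, add0r, subr0) => ->.
- apply: eq_bigr => i _.
  by rewrite binzN1 -exprMn mulrNN mulr1 expr1n scale1r !add0r exprN1 invrN1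
    scaleN1r opprK.
- by move=> i i0; rewrite binz_small // scale0r.
- by move=> i li; rewrite !add0r v0 // u0 // scaler0 subrr scaler0.
Qed.

(** The case p = -1, q = 0 applied to the vacuum. As x(-1 - i) 1 = L(-1)^i x / i!, this is the usual
    skew symmetry. *)
Lemma skew_symmetry u v (r : int) (k : nat) :
  (forall i : nat, (k <= i)%N -> Y u (r + i%:Z) v = 0) ->
  (-1 : R[i]) ^ r *: Y v r u =
    - \sum_(i < k) (-1) ^+ i *: Y (Y u (r + i%:Z) v) (-1 - i%:Z) vac.
Proof.
move=> u0; have := @borcherds_finite u v vac (-1) 0 r k 1.
rewrite big_ord1 expr0 binz0 mulr1 scale1r !(addr0, add0r, subr0).
rewrite (creation_regular hV) // mode0r sub0r (creation hV) => H.
apply/eqP; rewrite eq_sym eqr_oppLR -H.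
- by apply/eqP; apply: eq_bigr => i _; rewrite binzN1.
- by move=> i /u0 ->; rewrite mode0l scaler0.
- move=> i i0; rewrite !(creation_regular hV) ?mode0r ?scaler0 ?subrr ?scaler0 //.
  by case: i i0.
Qed.

Lemma vac_neq0 : vac != 0.
Proof.
have [v] := nontrivial hV; apply: contra_neq => vac0.
by rewrite -(creation hV v) vac0 mode0r.
Qed.

Lemma translation_mode v (n : int) w :
  Y (Y omega 0 v) n w = - n%:~R *: Y v (n - 1) w.
Proof. exact: (translation hV). Qed.

Lemma weight_spaceE n v : weight_space Y omega n v = (Y omega 1 v = n%:~R *: v).
Proof. by []. Qed.

Lemma weight_subspace n : is_subspace (weight_space Y omega n).
Proof.
apply/is_subspaceP; split=> [|c u v].
  by rewrite weight_spaceE mode0r scaler0.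
rewrite !weight_spaceE (linear_mode hV) => -> ->.
by rewrite scalerDr !scalerA mulrC.
Qed.

(** The commutator of L(0) = omega(1) with u(k) is (L(-1)u)(k + 1) + (L(0)u)(k), and [translation]
    evaluates the first term. *)
Lemma weight_mode (m n k : int) u v :
  weight_space Y omega m u -> weight_space Y omega n v ->
  weight_space Y omega (m + n - k - 1) (Y u k v).
Proof.
rewrite !weight_spaceE => um vn.
have : Y omega 1 (Y u k v) - Y u k (Y omega 1 v) =
    (m - k - 1)%:~R *: Y u k v.
  rewrite (@commutator _ _ _ _ _ 2); last first.
    by move=> i i0; rewrite binz_small // scale0r.
  rewrite !big_ord_recl big_ord0 /= -[bump 0 0]/1%N binz0 binz1 !scale1r !addr0.
  rewrite translation_mode.
  rewrite um modeZl [1 + k]addrC addrK -scalerDl; congr (_ *: _).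
  by rewrite -mulrNz -intrD opprD addrC addrA.
move/eqP; rewrite subr_eq => /eqP ->.
rewrite vn (lin_scale (Lr u k)) -scalerDl -intrD; congr (_%:~R *: _).
by rewrite [_ + n]addrC !addrA [n + m]addrC.
Qed.

Lemma weight_vac : weight_space Y omega 0 vac.
Proof. by rewrite weight_spaceE (creation_regular hV) // scale0r. Qed.

Lemma modeNl u n w : Y (- u) n w = - Y u n w.
Proof. exact: (lin_opp (Ll n w)). Qed.

Lemma mode_vac n (v : V) : Y vac n v = if n == -1 then v else 0.
Proof. exact: (vacuum hV). Qed.

(** * The center *)

Lemma centerE z : center Y omega z = (Y omega 0 z = 0).
Proof. by []. Qed.

(** By [translation], 0 = (L(-1)z)(n + 1) = -(n + 1) z(n). *)
Lemma center_mode z n w : center Y omega z -> n != -1 -> Y z n w = 0.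
Proof.
rewrite centerE => z0 nN1; have := translation_mode z (n + 1) w.
rewrite z0 mode0l addrK => /esym/eqP; rewrite scaler_eq0 oppr_eq0 intr_eq0.
by rewrite addr_eq0 (negPf nN1) => /eqP.
Qed.

(** Skew symmetry expresses u(i)z through the modes z(j) with j >= i, which vanish. *)
Lemma mode_center u z (i : nat) : center Y omega z -> Y u i%:Z z = 0.
Proof.
move=> Zz; have := @skew_symmetry z u i%:Z 0.
rewrite big_ord0 oppr0 => H; apply/eqP.
have /eqP := H (fun j _ => center_mode u Zz (isT : (i%:Z + j%:Z != -1))).
by rewrite scaler_eq0 expf_eq0 oppr_eq0 oner_eq0 andbF.
Qed.

Lemma center_commute u z w (p q : int) : center Y omega z ->
  Y u p (Y z q w) = Y z q (Y u p w).
Proof. by move=> Zz; apply: commutator0 => i; apply: mode_center. Qed.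

(** Since z(-1) is the only nonzero mode of [z], a single term of [iterate] remains. *)
Lemma center_iterate z x q w : center Y omega z ->
  Y (Y z (-1) x) q w = Y z (-1) (Y x q w).
Proof.
move=> Zz; rewrite (@iterate _ _ _ _ 1) ?big_ord1 /= ?subr0 ?addr0.
- by rewrite (center_mode _ Zz (isT : 0 != -1 :> int)) mode0r addr0.
- by case=> // i _; apply: center_mode.
- by move=> i _; rewrite (center_mode _ Zz) // mode0r.
Qed.

Lemma center_weight0 : center Y omega `<=` weight_space Y omega 0.
Proof. by move=> z Zz; rewrite weight_spaceE scale0r; apply: (@mode_center _ _ 1). Qed.

Lemma center_subspace : is_subspace (center Y omega).
Proof.
apply/is_subspaceP; split=> [|c u v]; first by rewrite centerE mode0r.
by rewrite !centerE (linear_mode hV) => -> ->; rewrite scaler0 addr0.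
Qed.

Lemma center_vac : center Y omega vac.
Proof. by rewrite centerE (creation_regular hV). Qed.

Lemma center_closed a b : center Y omega a -> center Y omega b ->
  center Y omega (Y a (-1) b).
Proof.
by move=> Za Zb; rewrite centerE center_commute // (Zb : Y omega 0 b = 0) mode0r.
Qed.

Lemma center_mulC a b : center Y omega b -> Y a (-1) b = Y b (-1) a.
Proof.
by move=> Zb; rewrite -{1}(creation hV b) center_commute // (creation hV).
Qed.

(** * Elements with commuting modes *)

Section SelfCommuting.
Variable a : V.

(** The vectors [w] for which Y(a, z) w has no pole at z = 0. *)
Definition annihilated : set V := [set w | forall i : nat, Y a i%:Z w = 0].

Lemma annihilated_subspace : is_subspace annihilated.
Proof.
apply/is_subspaceP; split=> [i|c u v u0 v0 i]; first exact: mode0r.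
by rewrite (linear_mode hV) u0 v0 scaler0 addr0.
Qed.

Lemma annihilated_vac : annihilated vac.
Proof. by move=> i; apply: (creation_regular hV). Qed.

Hypothesis aa : annihilated a.

Lemma mode_commute p q w : Y a p (Y a q w) = Y a q (Y a p w).
Proof. exact: commutator0. Qed.

Lemma annihilated_mode q w : annihilated w -> annihilated (Y a q w).
Proof. by move=> w0 i; rewrite mode_commute w0 mode0r. Qed.

Let T := Y a (-1).
Let lT : linear T := Lr a (-1).
(** The polynomial p(a) for the product x(-1)y, with the vacuum as 1. *)
Let ev (p : {poly R[i]}) := poly_op T p vac.

Lemma ev_annihilated p : annihilated (ev p).
Proof.
have Tann w : annihilated w -> annihilated (T w) by apply: annihilated_mode.
exact: (poly_op_subspace _ annihilated_subspace Tann annihilated_vac).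
Qed.

(** By induction on [p]: in the expansion of (a(-1)x)(i)w each term contains some x(i + j)w or a(j)w
    with j >= 0. *)
Lemma mode_ev p w (i : nat) : annihilated w -> Y (ev p) i%:Z w = 0.
Proof.
move=> w0; rewrite /ev; elim/poly_ind: p i => [|p c IH] i.
  by rewrite /poly_op size_poly0 big_ord0 mode0l.
rewrite (lin_add (poly_op_linearl _ _)) poly_opMX // poly_opC modeDl modeZl.
rewrite mode_vac scaler0 addr0 (@iterate _ _ _ _ 0) ?big_ord0 // => j _.
  by rewrite -PoszD IH mode0r.
by rewrite w0 mode0r.
Qed.

(** The same induction in mode -1, where only the term a(-1)x(-1)w survives. *)
Lemma modeN1_ev p w : annihilated w -> Y (ev p) (-1) w = poly_op T p w.
Proof.
move=> w0; elim/poly_ind: p => [|p c IH].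
  by rewrite /ev /poly_op !size_poly0 !big_ord0 mode0l.
rewrite /ev !(lin_add (poly_op_linearl _ _)) !poly_opMX // !poly_opC modeDl modeZl.
rewrite mode_vac eqxx; congr (_ + _).
rewrite (@iterate _ _ _ _ 1) ?big_ord1 ?subr0 ?addr0 -/(ev p).
- by rewrite IH w0 mode0r addr0.
- case=> // i _; have -> : -1 + i.+1%:Z = i%:Z by rewrite intS addKr.
  by rewrite mode_ev ?mode0r.
- by move=> i _; rewrite w0 mode0r.
Qed.

Lemma mul_ev p q : Y (ev p) (-1) (ev q) = ev (p * q).
Proof. by rewrite modeN1_ev ?[ev (p * q)](poly_opM lT) //; apply: ev_annihilated. Qed.

Lemma jordan_ev p q : jordan_mul Y (ev p) (ev q) = ev (p * q).
Proof.
rewrite /jordan_mul !mul_ev [q * p]mulrC -mulr2n -(scaler_nat 2 (ev _)) scalerA.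
by rewrite mulVf ?scale1r // pnatr_eq0.
Qed.

Lemma iter_jordan_ev p n : iter n (jordan_mul Y (ev p)) (ev p) = ev (p ^+ n.+1).
Proof. by elim: n => //= n ->; rewrite jordan_ev -exprS. Qed.

Lemma ev_X : ev 'X = a.
Proof. by rewrite /ev poly_opX // /T (creation hV). Qed.

Lemma ev_XsubC c : ev ('X - c%:P) = a - c *: vac.
Proof.
by rewrite /ev (lin_sub (poly_op_linearl _ _)) -/(ev 'X) ev_X poly_opC.
Qed.

(* The translation operator is a derivation, so d := L(-1)a satisfies d = 2ad,
   whence ad = 2aad = 2ad and d = 0. *)
Lemma idempotent_center : Y a (-1) a = a -> center Y omega a.
Proof.
move=> idem; rewrite centerE; set d := Y omega 0 a.
have dE : d = Y a (-2) vac.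
  rewrite -(creation hV d) translation_mode.
  by rewrite -[- (-1)%:~R]/(- (-1)) opprK scale1r.
have dd : d = 2%:R *: Y a (-1) d.
  rewrite /d -{1}idem; have := mode0_derivation omega a a (-1).
  move/eqP; rewrite subr_eq => /eqP ->.
  rewrite translation_mode -[- (-1)%:~R]/(- (-1)) opprK scale1r (_ : -1 - 1 = -2) //.
  rewrite -{2}(creation hV a) mode_commute -dE -/d.
  by rewrite scaler_nat mulr2n.
(* As d = a(-2) 1 and the modes of [a] commute, both sides equal a(-2)a. *)
have add : Y a (-1) (Y a (-1) d) = Y a (-1) d.
  rewrite dE ![Y a (-1) (Y a (-2) _)]mode_commute (creation hV).
  by rewrite idem.
have ad : Y a (-1) d = 0.
  have := congr1 T dd; rewrite (lin_scale lT) /T add => /eqP.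
  rewrite scaler_nat mulr2n -subr_eq0 opprD addrA subrr sub0r oppr_eq0.
  by move/eqP.
by rewrite dd ad scaler0.
Qed.

End SelfCommuting.

(** * The algebra of weight zero *)

Section WeightAtLeastMinusOne.
Hypothesis hV_lt : forall n : int, n < -1 -> weight_space Y omega n = [set 0].

Local Notation V0 := (weight_space Y omega 0).
Local Notation jordan := (jordan_mul Y).

Lemma weight_lt n v : n < -1 -> weight_space Y omega n v -> v = 0.
Proof. by move/hV_lt => ->. Qed.

Lemma weight0_mode a n v : V0 a -> weight_space Y omega n v ->
  forall k : int, weight_space Y omega (n - k - 1) (Y a k v).
Proof. by move=> a0 vn k; have := weight_mode k a0 vn; rewrite add0r. Qed.

Lemma weight0_mul a b : V0 a -> V0 b -> V0 (Y a (-1) b).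
Proof. by move=> a0 b0; have := weight0_mode a0 b0 (-1). Qed.

(** The vector a(i)b has weight -i - 1 < -1. *)
Lemma weight0_mode_eq0 a b (i : nat) : V0 a -> V0 b -> (0 < i)%N -> Y a i%:Z b = 0.
Proof.
move=> a0 b0 i0; apply: weight_lt (weight0_mode a0 b0 i%:Z).
by rewrite sub0r ltrBlDr addNr oppr_lt0 ltz_nat.
Qed.

Lemma weightN1_mode_eq0 a b (i : nat) :
  V0 a -> weight_space Y omega (-1) b -> Y a i%:Z b = 0.
Proof.
move=> a0 b0; apply: weight_lt (weight0_mode a0 b0 i%:Z).
by rewrite ltrBlDr addNr -opprD oppr_lt0.
Qed.

Lemma weight0_self_annihilated a : V0 a -> annihilated a a.
Proof.
move=> a0 [|i]; last exact: weight0_mode_eq0.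
(* The higher terms vanish by weight, which leaves a(0)a = - a(0)a. *)
have := @skew_symmetry a a 0 1; rewrite big_ord1 expr0z !scale1r addr0 subr0.
rewrite (creation hV) => H; have /eqP := H (fun i i0 => weight0_mode_eq0 a0 a0 i0).
by rewrite -addr_eq0 -mulr2n -(scaler_nat 2) scaler_eq0 pnatr_eq0 => /eqP.
Qed.

Lemma weight0_ev a p : V0 a -> V0 (poly_op (Y a (-1)) p vac).
Proof.
move=> a0; have Ta w : V0 w -> V0 (Y a (-1) w) by apply: weight0_mul.
exact: (poly_op_subspace _ (weight_subspace 0) Ta weight_vac).
Qed.

Lemma jordan_algebra : findim_unital_algebra V0 jordan vac.
Proof.
have sub0 := weight_subspace 0.
have two a : 2%:R^-1 *: (a + a) = a :> V.
  by rewrite -mulr2n -(scaler_nat 2 a) scalerA mulVf ?scale1r // pnatr_eq0.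
have jC a b : jordan a b = jordan b a by rewrite /jordan_mul addrC.
have jl c a b x : jordan (c *: a + b) x = c *: jordan a x + jordan b x.
  rewrite /jordan_mul modeDl modeZl (linear_mode hV) addrACA -scalerDr [LHS]scalerDr.
  by rewrite !scalerA [c * _]mulrC.
have jv a : jordan vac a = a.
  by rewrite /jordan_mul mode_vac eqxx (creation hV) two.
split=> //.
- exact: weight_findim hV 0.
- move=> a b a0 b0; apply: subspaceZ => //.
  by apply: subspaceD => //; apply: weight0_mul.
- by move=> c a b x _ _ _; rewrite ![jordan x _]jC.
- exact: weight_vac.
- by move=> a _; rewrite jC.
Qed.

Lemma jordanC : alg_commutative V0 jordan.
Proof. by move=> a b _ _; rewrite /jordan_mul addrC. Qed.

(** The polynomials in [a] form a subalgebra containing [a], on which the Jordan product is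
    multiplication of polynomials. *)
Lemma jordan_power_associative : power_associative V0 jordan.
Proof.
move=> a a0; have aa := weight0_self_annihilated a0.
pose ev p := poly_op (Y a (-1)) p vac.
have evP x : subalgebra_gen V0 jordan a x -> exists p, x = ev p.
  move=> /(_ (range ev)); case=> [|p _ <-]; last by exists p.
  split; last by move=> _ ->; exists 'X => //; apply: ev_X.
  split.
  - by move=> _ [p _ <-]; apply: weight0_ev.
  - apply/is_subspaceP; split.
      by exists 0 => //; rewrite /ev (lin_0 (poly_op_linearl _ _)).
    move=> c _ _ [p _ <-] [q _ <-]; exists (c *: p + q) => //.
    by rewrite /ev poly_op_linearl.
  - move=> _ _ [p _ <-] [q _ <-]; exists (p * q) => //.
    by rewrite /ev -(jordan_ev aa).
move=> _ _ _ /evP[p ->] /evP[q ->] /evP[r ->].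
by rewrite /ev !(jordan_ev aa) mulrA.
Qed.

Lemma iter_jordan a n : V0 a ->
  iter n (jordan a) a = poly_op (Y a (-1)) 'X^(n.+1) vac.
Proof.
move=> a0; have aa := weight0_self_annihilated a0.
by have := iter_jordan_ev aa 'X n; rewrite ev_X.
Qed.

(* Y(a,z)^n = Y(a^n,z) on the vectors killed by the modes a(i), i >= 0.  These
   include V_{-1}, hence also a(-1)^k V_0 as soon as a(-1)^k V_{-1} = 0. *)
Lemma nilpotent_mode a : V0 a -> alg_nilpotent jordan a ->
  exists k, forall v, V0 v -> iter k (Y a (-1)) v = 0.
Proof.
move=> a0 [n]; rewrite iter_jordan // => an.
have aa := weight0_self_annihilated a0.
have ann w : annihilated a w -> iter n.+1 (Y a (-1)) w = 0.
  by move=> w0; rewrite -poly_op_Xn // -(modeN1_ev _ w0) an mode0l.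
(* The first n + 1 applications of a(-1) lead into [annihilated a], and n + 1 more give zero. *)
exists (n.+1 + n.+1)%N => v v0; rewrite iterD; apply: (ann) => i.
have comm k : Y a i%:Z (iter k (Y a (-1)) v) = iter k (Y a (-1)) (Y a i%:Z v).
  by elim: k => //= k <-; rewrite (mode_commute aa).
rewrite comm; apply: (ann) => j.
case: i {comm} => [|i]; last by rewrite (weight0_mode_eq0 a0 v0) // mode0r.
apply: weightN1_mode_eq0 => //.
by have := weight0_mode a0 v0 0; rewrite subr0 sub0r.
Qed.

(** The modes of [u] preserve [I], but x(-1)u with [x] in [I] must also be treated: skew symmetry
    writes it with the vectors (u(i - 1)x)(-1 - i) 1. *)
Lemma jordan_ideal I : voa_ideal Y I -> alg_ideal V0 jordan (I `&` V0).
Proof.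
move=> [subI modeI]; have sub0 := weight_subspace 0.
(* Up to a nonzero scalar, x(-1 - i) 1 is L(-1)^i x, and L(-1) = omega(0) preserves [I]. *)
have N1I x (i : nat) : I x -> I (Y x (-1 - i%:Z) vac).
  elim: i x => [|i IH] x Ix; first by rewrite subr0 (creation hV).
  have /IH : I (Y omega 0 x) by apply: modeI.
  rewrite translation_mode [_ - 1](_ : _ = -1 - i.+1%:Z); last first.
    by rewrite intS opprD addrA addrAC.
  move/(subspaceZ subI (- (-1 - i%:Z)%:~R)^-1); rewrite scalerK //.
  by rewrite -mulrNz intr_eq0 opprB opprK addrC.
have rI u x : V0 u -> V0 x -> I x -> I (Y x (-1) u).
  move=> u0 x0 Ix; have := @skew_symmetry u x (-1) 2.
  rewrite exprN1 invrN1 scaleN1r => H.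
  have ux0 (i : nat) : (2 <= i)%N -> Y u (-1 + i%:Z) x = 0.
    by case: i => [|i] //; rewrite intS addKr => i0; apply: weight0_mode_eq0.
  have /oppr_inj -> := H ux0.
  by apply: subspace_sum => // i _; apply: subspaceZ => //; apply: N1I; apply: modeI.
split=> [x []//||a x a0 [Ix x0]].
  apply/is_subspaceP; split; first by split; apply: subspace0.
  move=> c u v [Iu u0] [Iv v0].
  by split; apply: subspaceD => //; apply: subspaceZ.
suff H : (I `&` V0) (jordan a x) by split=> //; rewrite (jordanC x0 a0).
split; last exact: alg_mul jordan_algebra _ _ a0 x0.
apply: subspaceZ => //; apply: subspaceD => //; last exact: rI.
exact: modeI.
Qed.

(** * Nilpotent elements of weight zero *)

Definition nilpotents : set V := [set a | V0 a /\ alg_nilpotent jordan a].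

Section TrivialIdempotents.
Hypothesis idem : forall f, center Y omega f -> Y f (-1) f = f -> f = 0 \/ f = vac.

(** Some nonzero polynomial in a(-1) kills the vacuum. Idempotents among the p(a) are central by
    [idempotent_center], hence trivial, so [poly_op_unipotent] gives (a - c)^k = 0. *)
Lemma scalar_plus_nilpotent a : V0 a -> exists c, nilpotents (a - c *: vac).
Proof.
move=> a0; have aa := weight0_self_annihilated a0.
have sub0 := weight_subspace 0.
have Ta w : V0 w -> V0 (Y a (-1) w) by apply: weight0_mul.
have [p p0 pv] := poly_op_eq0 sub0 (weight_findim hV 0) Ta weight_vac.
have [|c [k ck]] := poly_op_unipotent (Lr a (-1)) vac_neq0 p0 pv.
  move=> e; rewrite -(mul_ev aa) => ee; apply: idem => //.
  by apply: idempotent_center ee; apply: weight0_self_annihilated; apply: weight0_ev.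
exists c; split.
  by apply: subspaceB => //; apply: subspaceZ => //; apply: weight_vac.
(* [alg_nilpotent] counts from exponent 1, so this is the power k + 1. *)
exists k; rewrite -ev_XsubC iter_jordan_ev // exprS poly_opM // ck.
by rewrite (poly_op0 (Lr a (-1))).
Qed.

Lemma nilpotents_vac : ~ nilpotents vac.
Proof.
move=> [_ nv]; have := vac_neq0; rewrite (idem_nilpotent _ nv) ?eqxx //.
exact: alg_unitl jordan_algebra _ weight_vac.
Qed.

(** A sum of two nilpotents is d 1 plus a nilpotent. The (-1)-modes of all three nilpotents are
    nilpotent on V_0, so comparing traces gives d = 0. *)
Lemma nilpotents_subspace : is_subspace nilpotents.
Proof.
have sub0 := weight_subspace 0.
have nZ c a : nilpotents a -> nilpotents (c *: a).
  move=> [a0 [n an]]; split; first exact: subspaceZ.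
  have aa := weight0_self_annihilated a0.
  exists n; have -> : c *: a = poly_op (Y a (-1)) (c *: 'X) vac.
    by rewrite (lin_scale (poly_op_linearl _ _)) ev_X.
  rewrite iter_jordan_ev // exprZn (lin_scale (poly_op_linearl _ _)).
  by rewrite -iter_jordan // an scaler0.
apply/is_subspaceP; split=> [|c a b /(nZ c) [ca0 can] [b0 bn]].
  by split; [apply: subspace0 | exists 0].
have ab0 : V0 (c *: a + b) by apply: subspaceD.
have [d [d0 dn]] := scalar_plus_nilpotent ab0.
suff d00 : d = 0 by move: d0 dn; rewrite d00 scale0r subr0.
have stable x : V0 x -> forall v, V0 v -> V0 (Y x (-1) v).
  by move=> x0 v; apply: weight0_mul.
apply: (scalar_sum_nilpotent sub0 (weight_findim hV 0) (Lr (c *: a) (-1))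
  (Lr b (-1)) (Lr (c *: a + b - d *: vac) (-1)) _ _ _ _ _ _ _ weight_vac vac_neq0);
  try by [apply: stable | apply: nilpotent_mode].
move=> v _; rewrite modeDl (modeDl (c *: a)) modeNl (modeZl d) mode_vac eqxx.
by rewrite [RHS]addrC subrK.
Qed.

Lemma nilpotents_sqr a : nilpotents a -> nilpotents (jordan a a).
Proof.
move=> [a0 [n an]]; have aa := weight0_self_annihilated a0.
split; first exact: (alg_mul jordan_algebra).
exists n; have -> : jordan a a = poly_op (Y a (-1)) ('X * 'X) vac.
  by rewrite -jordan_ev // ev_X.
rewrite iter_jordan_ev // exprMn poly_opM // -[X in poly_op _ _ X]iter_jordan // an.
by rewrite (poly_op0 (Lr a (-1))).
Qed.

Lemma weight0_local : local_algebra V0 jordan vac.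
Proof.
apply: (local_algebra_nil jordan_algebra jordan_power_associative jordanC
  nilpotents_subspace).
- by move=> a [].
- by move=> a [].
- exact: nilpotents_sqr.
- exact: nilpotents_vac.
- exact: scalar_plus_nilpotent.
Qed.

End TrivialIdempotents.

(** * Locality of the center *)

Lemma center_algebra : findim_unital_algebra (center Y omega) (center_mul Y) vac.
Proof.
split=> *; rewrite /center_mul.
- exact: center_subspace.
- have [s sP] := weight_findim hV 0; exists s => v /center_weight0; exact: sP.
- exact: center_closed.
- by rewrite modeDl modeZl.
- by rewrite (linear_mode hV).
- exact: center_vac.
- by rewrite mode_vac eqxx.
- by rewrite (creation hV).
Qed.

Lemma center_idem : local_algebra (center Y omega) (center_mul Y) vac ->
  forall f, center Y omega f -> Y f (-1) f = f -> f = 0 \/ f = vac.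
Proof. by move=> lZ f Zf ff; apply: local_algebra_idem center_algebra _ lZ Zf ff. Qed.

Lemma center_mulE a b : center Y omega a -> center Y omega b ->
  center_mul Y a b = jordan a b.
Proof.
move=> Za Zb; rewrite /center_mul /jordan_mul -(center_mulC a Zb) -mulr2n.
by rewrite -(scaler_nat 2 (Y _ _ _)) scalerA mulVf ?scale1r // pnatr_eq0.
Qed.

(** The two products agree on the center, so the central elements of [nilpotents] satisfy the
    criterion [local_algebra_nil]. *)
Lemma center_local :
  (forall f, center Y omega f -> Y f (-1) f = f -> f = 0 \/ f = vac) ->
  local_algebra (center Y omega) (center_mul Y) vac.
Proof.
move=> idem; have subZ := center_subspace.
have subN := nilpotents_subspace idem.
apply: (local_algebra_nil center_algebra (N := center Y omega `&` nilpotents)).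
- move=> a Za x y z.
  have gZ u : subalgebra_gen (center Y omega) (center_mul Y) a u -> center Y omega u.
    apply; split; last by move=> _ ->.
    by split=> // b c; apply: center_closed.
  move=> /gZ Zx _ _; by rewrite /center_mul center_iterate.
- by move=> a b Za Zb; apply: center_mulC.
- apply/is_subspaceP; split; first by split; apply: subspace0.
  move=> c u v [Zu nu] [Zv nv]; split; apply: subspaceD => //; exact: subspaceZ.
- by move=> a [].
- move=> a [Za [_ [n an]]]; exists n; rewrite -an.
  suff [] : iter n (center_mul Y a) a = iter n (jordan a) a /\
    center Y omega (iter n (center_mul Y a) a) by [].
  elim: {an} n => //= n [<- Zn]; split; first exact: center_mulE.
  exact: center_closed.
- move=> a [Za na]; split; first exact: center_closed.
  by rewrite center_mulE //; apply: nilpotents_sqr.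
- by move=> [_]; apply: nilpotents_vac.
- move=> a Za; have [c nc] := scalar_plus_nilpotent idem (center_weight0 Za).
  exists c; split=> //; apply: subspaceB => //; apply: subspaceZ => //.
  exact: center_vac.
Qed.

End WeightAtLeastMinusOne.

(** * Ideals *)

Lemma voa_ideal_vac I : voa_ideal Y I -> I vac -> I = setT.
Proof.
move=> [_ modeI] Iv; apply/seteqP; split=> // v _.
by rewrite -(creation hV v); apply: modeI.
Qed.

Lemma voa_ideal_add I J : voa_ideal Y I -> voa_ideal Y J ->
  voa_ideal Y [set v | exists a b, [/\ I a, J b & v = a + b]].
Proof.
move=> [subI modeI] [subJ modeJ]; split.
  apply/is_subspaceP; split.
    by exists 0, 0; rewrite addr0; split=> //; apply: subspace0.
  move=> c _ _ [a [b [Ia Jb ->]]] [a' [b' [Ia' Jb' ->]]].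
  exists (c *: a + a'), (c *: b + b'); split; last by rewrite scalerDr addrACA.
    by apply: subspaceD => //; apply: subspaceZ.
  by apply: subspaceD => //; apply: subspaceZ.
move=> u n _ [a [b [Ia Jb ->]]]; exists (Y u n a), (Y u n b).
by split; [apply: modeI | apply: modeJ | apply: lin_add (Lr u n) _ _].
Qed.

(** The operator L(0) - m kills the component of weight m and multiplies each other one by n - m,
    nonzero; induction then applies. *)
Lemma ideal_homogeneous I (s : seq int) (f : int -> V) :
  voa_ideal Y I -> uniq s -> (forall n, weight_space Y omega n (f n)) ->
  I (\sum_(n <- s) f n) -> forall n, n \in s -> I (f n).
Proof.
move=> [subI modeI]; elim: s f => // m s IH f /= /andP[ms us] wf.
rewrite big_cons => If.
have Is n : n \in s -> I (f n).
  move=> ns; have nm : n - m != 0.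
    by rewrite subr_eq0; apply: contraNneq ms => <-.
  have nmC : (n - m)%:~R != 0 :> R[i] by rewrite intr_eq0.
  rewrite -[f n](scalerK nmC); apply: subspaceZ => //.
  apply: (IH (fun k => (k - m)%:~R *: f k)) ns => // [k|].
    by apply: subspaceZ => //; apply: weight_subspace.
  have := subspaceB subI (modeI omega 1 _ If) (subspaceZ subI m%:~R If).
  have wfE k : Y omega 1 (f k) = k%:~R *: f k by apply: wf.
  rewrite !(lin_add (Lr omega 1)) wfE scalerDr opprD addrACA subrr add0r.
  rewrite (lin_sum (Lr omega 1)) scaler_sumr -sumrB.
  congr I; apply: eq_bigr => k _.
  by rewrite wfE -scalerBl -intrB.
have Im : I (f m).
  rewrite -(addrK (\sum_(n <- s) f n) (f m)); apply: subspaceB => //.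
  by rewrite big_seq; apply: subspace_sum.
by move=> n; rewrite in_cons => /predU1P[->|/Is].
Qed.

Lemma weight_decomposition v : exists (s : seq int) (f : int -> V),
  [/\ uniq s, 0 \in s, forall n, weight_space Y omega n (f n) & v = \sum_(n <- s) f n].
Proof.
have [s [f [wf ->]]] := graded hV v.
(* Weights may repeat in [s], so each component takes its multiplicity; if 0 is not in [s] its
   component is zero. *)
exists (undup (0 :: s)), (fun n => f n *+ count_mem n s); split.
- exact: undup_uniq.
- by rewrite mem_undup mem_head.
- move=> n; rewrite -(scaler_nat _ (f n)).
  by apply: subspaceZ; [apply: weight_subspace | apply: wf].
- have : {subset s <= undup (0 :: s)}.
    by move=> n ns; rewrite mem_undup in_cons ns orbT.
  have := undup_uniq (0 :: s); move: (undup _) => t ut.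
  elim: s => [|m s IH] st; first by rewrite big_nil big1.
  have mt : m \in t by apply: st; rewrite mem_head.
  rewrite big_cons IH; last by move=> n ns; apply: st; rewrite in_cons ns orbT.
  under [RHS]eq_bigr do rewrite /= mulrnDr.
  rewrite big_split /=; congr (_ + _).
  rewrite (bigD1_seq m) //= eqxx big1 ?addr0 //.
  by move=> n /negPf nm; rewrite eq_sym nm.
Qed.

(* Ideals are graded, so if I + J contains the vacuum then so does the sum of
   the degree-zero parts of I and J. *)
Lemma voa_ideal_add_vac I J : voa_ideal Y I -> voa_ideal Y J ->
  (exists a b, [/\ I a, J b & vac = a + b]) ->
  exists a b, [/\ (I `&` weight_space Y omega 0) a,
                  (J `&` weight_space Y omega 0) b & vac = a + b].
Proof.
move=> idI idJ [a [b [Ia Jb vE]]].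
have [s [f [us s0 wf aE]]] := weight_decomposition a.
have sub0 := weight_subspace 0; have v0 := weight_vac.
exists (f 0), (vac - f 0); split; last by rewrite addrC subrK.
  by split=> //; apply: (ideal_homogeneous idI us wf) => //; rewrite -aE.
split; last exact: subspaceB.
(* The homogeneous components of b = 1 - a, the vacuum having weight 0. *)
pose g n := if n == 0 then vac - f 0 else - f n.
apply: (@ideal_homogeneous J s g idJ us _ _ 0) => // [n|].
  rewrite /g; case: eqP => [->|_]; first exact: subspaceB.
  by apply: subspaceN; [apply: weight_subspace | apply: wf].
suff -> : \sum_(n <- s) g n = b by [].
have -> : b = vac - a by rewrite vE addrC addKr.
rewrite aE !(bigD1_seq 0 s0 us) /= /g eqxx opprD addrA; congr (_ + _).
by rewrite -sumrN; apply: eq_bigr => n /negPf ->.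
Qed.

(** The union of all proper ideals is the largest one: a sum of two of them is proper, as otherwise
    the vacuum would be a sum of two elements of [N]. *)
Lemma voa_local_of_proper (N : set V) :
  (forall I, voa_ideal Y I -> I <> setT -> I `&` weight_space Y omega 0 `<=` N) ->
  is_subspace N -> ~ N vac -> voa_local Y.
Proof.
move=> IN subN Nv.
pose M := [set v | exists I, [/\ voa_ideal Y I, I <> setT & I v]].
have proper0 : voa_ideal Y [set 0] /\ [set (0 : V)] <> setT.
  split; last first.
    move=> E; have : setT vac by []; rewrite -E => /eqP.
    by rewrite (negPf vac_neq0).
  split; last by move=> u n _ ->; rewrite /= mode0r.
  by apply/is_subspaceP; split=> // c _ _ -> ->; rewrite /= scaler0 addr0.
have idM : voa_ideal Y M.
  split; last first.
    move=> u n a [I [[subI modeI] IT Ia]]; exists I; split=> //.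
    exact: modeI.
  apply/is_subspaceP; split.
    by exists [set 0]; case: proper0.
  move=> c u v [I [idI IT Iu]] [J [idJ JT Jv]].
  exists [set v | exists a b, [/\ I a, J b & v = a + b]]; split.
  - exact: voa_ideal_add.
  - move=> E; have : setT vac by []; rewrite -E => /(voa_ideal_add_vac idI idJ).
    move=> [a [b [/(IN _ idI IT) Na /(IN _ idJ JT) Nb vE]]].
    by apply: Nv; rewrite vE; apply: subspaceD.
  - by exists (c *: u), v; split=> //; apply: subspaceZ => //; case: idI.
have MT : M <> setT.
  move=> E; have : M vac by rewrite E.
  by move=> [I [idI IT /(voa_ideal_vac idI)]].
have maxM I : voa_ideal Y I -> I <> setT -> I `<=` M by move=> idI IT v Iv; exists I.
exists M; split.
  split=> // J idJ MJ JT; apply/seteqP; split=> //; exact: maxM.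
move=> J [idJ JT maxJ]; apply: maxJ => //; exact: maxM.
Qed.

(** An ideal is proper iff it misses the vacuum, so unions of nonempty chains of proper ideals are
    proper and Zorn's lemma applies. *)
Lemma maximal_ideal_exists I : voa_ideal Y I -> I <> setT ->
  exists M, voa_maximal_ideal Y M /\ I `<=` M.
Proof.
move=> idI IT.
pose P := [set J | J = set0 \/ [/\ voa_ideal Y J, J <> setT & I `<=` J]].
have Pelt J v : P J -> J v -> [/\ voa_ideal Y J, J <> setT & I `<=` J].
  by move=> [->|].
have I0 : I 0 by case: idI => subI _; apply: subspace0.
have chain F : F `<=` P -> total_on F subset -> P (\bigcup_(J in F) J).
  move=> FP Ftot.
  have [[v [J0 FJ0 J0v]]|F0] := pselect ((\bigcup_(J in F) J) !=set0); last first.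
    by left; apply/seteqP; split=> // x Ux; apply: F0; exists x.
  have [[subJ0 _] J0T IJ0] := Pelt _ _ (FP _ FJ0) J0v.
  right; split.
  - split; last first.
      move=> u n a [J FJ Ja]; exists J => //.
      by have [[_ modeJ] _ _] := Pelt _ _ (FP _ FJ) Ja; apply: modeJ.
    apply/is_subspaceP; split; first by exists J0 => //; apply: subspace0.
    move=> c x y [J FJ Jx] [J' FJ' J'y].
    have [[subJ _] _ _] := Pelt _ _ (FP _ FJ) Jx.
    have [[subJ' _] _ _] := Pelt _ _ (FP _ FJ') J'y.
    have [JJ'|J'J] := Ftot _ _ FJ FJ'.
      by exists J' => //; apply: subspaceD => //; apply: subspaceZ => //; apply: JJ'.
    by exists J => //; apply: subspaceD => //; [apply: subspaceZ | apply: J'J].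
  - move=> E; have [J FJ Jvac] : (\bigcup_(J in F) J) vac by rewrite E.
    have [idJ JT _] := Pelt _ _ (FP _ FJ) Jvac.
    by apply: JT; apply: voa_ideal_vac.
  - by move=> x Ix; exists J0 => //; apply: IJ0.
have [M [PM maxM]] := Zorn_bigcup chain.
have PI : P I by right; split.
have [M0|[idM MT IM]] := PM.
  case: (maxM I) => //; rewrite M0; split=> // /(_ 0 I0) //.
exists M; split=> //; split=> // J idJ MJ JT; apply: contrapT => JM.
apply: (maxM J); last by right; split=> //; apply: subset_trans MJ.
by split=> // JsubM; apply: JM; apply/seteqP.
Qed.

(** Two complementary nonzero ideals are proper, so both lie in the unique maximal ideal, which
    would then be all of V. *)
Lemma local_indecomposable : voa_local Y -> voa_indecomposable Y.
Proof.
move=> [M [_ Muniq]] [I [J [[idI I0] [idJ J0] IJ sumIJ]]].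
have proper A B : voa_ideal Y A -> A `&` B = [set 0] -> voa_ideal Y B ->
    B <> [set 0] -> A <> setT.
  by move=> _ AB _ B0 AT; apply: B0; rewrite -AB AT setTI.
have IT := proper I J idI IJ idJ J0.
have JT := proper J I idJ (etrans (setIC _ _) IJ) idI I0.
have [MI [maxMI IMI]] := maximal_ideal_exists idI IT.
have [MJ [maxMJ JMJ]] := maximal_ideal_exists idJ JT.
rewrite -(Muniq _ maxMI) in IMI; rewrite -(Muniq _ maxMJ) in JMJ.
have [[subM _] MT _] : voa_maximal_ideal Y M by rewrite (Muniq _ maxMI).
apply: MT; apply/seteqP; split=> // v _.
have [a [b [Ia Jb ->]]] := sumIJ v.
by apply: subspaceD => //; [apply: IMI | apply: JMJ].
Qed.

(** The modes of a central element commute with all modes, so the image of the projection e(-1) is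
    an ideal. *)
Lemma center_idempotent_ideal e : center Y omega e -> Y e (-1) e = e ->
  voa_ideal Y [set v | Y e (-1) v = v].
Proof.
move=> Ze ee; split.
  apply/is_subspaceP; split=> [|c u v /= Eu Ev]; first exact: mode0r.
  by rewrite /= (linear_mode hV) Eu Ev.
by move=> u n a /= ea; rewrite -center_commute // ea.
Qed.

Lemma indecomposable_idem : voa_indecomposable Y ->
  forall f, center Y omega f -> Y f (-1) f = f -> f = 0 \/ f = vac.
Proof.
move=> ind f Zf ff; apply: contrapT => /not_orP[f0 fv]; apply: ind.
pose g := vac - f.
have gE v : Y g (-1) v = v - Y f (-1) v.
  by rewrite /g modeDl modeNl mode_vac eqxx.
have Zg : center Y omega g by apply: (subspaceB center_subspace center_vac).
have gg : Y g (-1) g = g.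
  rewrite gE {2}/g (lin_sub (Lr f (-1))) (creation hV) ff subrr subr0 //.
(* The operators f(-1) and g(-1) are complementary projections. *)
exists [set v | Y f (-1) v = v], [set v | Y g (-1) v = v]; split.
- split; first exact: center_idempotent_ideal.
  by move=> E; apply: f0; have : [set (0 : V)] f by rewrite -E.
- split; first exact: center_idempotent_ideal.
  move=> E; apply: fv; have : [set (0 : V)] g by rewrite -E.
  by rewrite /g /= => /eqP; rewrite subr_eq0 => /eqP.
- apply/seteqP; split=> [v [/= fv' gv]|_ ->]; last by split; rewrite /= mode0r.
  by rewrite /= -gv gE fv' subrr.
- move=> v; exists (Y f (-1) v), (Y g (-1) v); split=> /=.
  + by rewrite -center_iterate // ff.
  + by rewrite -center_iterate // gg.
  + by rewrite gE addrC subrK.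
Qed.

(** The weight zero part of a proper ideal misses the vacuum, so it is a proper ideal of V_0 and
    lies in [N]. *)
Lemma jordan_local_voa_local :
  (forall n : int, n < -1 -> weight_space Y omega n = [set 0]) ->
  local_algebra (weight_space Y omega 0) (jordan_mul Y) vac -> voa_local Y.
Proof.
move=> hV_lt /(local_algebra_proper jordan_algebra)[N [subN Nv NJ]].
apply: (voa_local_of_proper _ subN Nv) => I idI IT.
apply: NJ; first exact: jordan_ideal.
by move=> [/(voa_ideal_vac idI)].
Qed.

End VertexOperatorAlgebras.

Theorem theorem2 (R : realType) (V : lmodType R[i])
    (Y : V -> int -> V -> V) (vac omega : V)
    (hV : is_voa Y vac omega)
    (hV_lt : forall n : int, n < -1 -> weight_space Y omega n = [set 0]) :
  [<-> voa_local Y;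
       voa_indecomposable Y;
       local_algebra (center Y omega) (center_mul Y) vac;
       [/\ alg_commutative (weight_space Y omega 0) (jordan_mul Y),
           power_associative (weight_space Y omega 0) (jordan_mul Y) &
           local_algebra (weight_space Y omega 0) (jordan_mul Y) vac]].
Proof.
tfae.
- exact: local_indecomposable hV.
- by move=> /(indecomposable_idem hV); apply: center_local.
- move=> /(center_idem hV) idem; split; first exact: jordanC.
    exact: jordan_power_associative hV hV_lt.
  exact: weight0_local.
- by move=> [_ _]; apply: jordan_local_voa_local hV hV_lt.
Qed.
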